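(* Let $d, n$ be positive integers. The $a$-floor quotient partial order on the interval $\mathcal{Q}_a[d,n]$ is identical to the divisor partial order on the interval $\mathcal{D}[d,n]$ when $a \ge \lfloor n/d \rfloor$; that is, $$(\mathcal{Q}_a[d,n], \preccurlyeq_a) = (\mathcal{D}[d,n], \mid) \quad \text{for all positive integers } a \ge \left\lfloor \frac{n}{d} \right\rfloor$$ (equal as sets, with the same order relation). If in addition $d \mid n$, then the $a$-floor quotient order on the interval $\mathcal{Q}_a[d,n]$ is identical to the divisor partial order on $\mathcal{D}[d,n]$ for all positive integers $a \ge \left\lfloor \frac{n}{d+1} \right\rfloor$.
   Context: $\mathbb{N}^+ = \{1,2,3,\ldots\}$. For positive integers $d, n$, one writes $d \preccurlyeq_1 n$ if $d = \lfloor n/k \rfloor$ for some positive integer $k$. For an integer $a \ge 1$, one writes $d \preccurlyeq_a n$ (''$d$ is an $a$-floor quotient of $n$'') if and only if $ad \preccurlyeq_1 an$, i.e. there is a positive integer $k$ with $ad = \lfloor an/k \rfloor$; this is a partial order on $\mathbb{N}^+$. The interval $\mathcal{Q}_a[d,n]$ is $\{e \in \mathbb{N}^+ : d \preccurlyeq_a e \text{ and } e \preccurlyeq_a n\}$, and $\mathcal{D}[d,n] = \{e \in \mathbb{N}^+ : d \mid e \text{ and } e \mid n\}$; each is empty if its endpoints are not comparable in the corresponding order ($d \not\preccurlyeq_a n$, respectively $d \nmid n$). *)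

(* Defs.v *)
(* MathComp; the intervals are sets in the sense of classical_sets. *)
From mathcomp Require Import all_boot.
From mathcomp Require Import classical_sets.

Set Implicit Arguments.
Unset Strict Implicit.
Unset Printing Implicit Defensive.

(* Elements of N^+ are represented by nat. The relations are only meant on
   positive arguments: [floor_quotient1 0 n] holds for every n (take k > n), so
   the intervals below require positivity of their elements explicitly. *)

Definition floor_quotient1 (d n : nat) : Prop :=
  exists k : nat, 0 < k /\ d = n %/ k.

Definition floor_quotient (a d n : nat) : Prop :=
  floor_quotient1 (a * d) (a * n).

Definition floor_quotient_interval (a d n : nat) : set nat :=
  [set e | [/\ 0 < e, floor_quotient a d e & floor_quotient a e n]]%classic.

Definition divides (d n : nat) : Prop := d %| n.

Definition divisor_interval (d n : nat) : set nat :=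
  [set e | [/\ 0 < e, divides d e & divides e n]]%classic.

(* (A, leA) = (B, leB): the same underlying set, and the two relations have the
   same restriction to it. *)
Definition same_poset (T : Type) (A : set T) (leA : T -> T -> Prop)
    (B : set T) (leB : T -> T -> Prop) : Prop :=
  A = B /\ (forall x y : T, A x -> A y -> (leA x y <-> leB x y)).

(* Main.v *)
Require Import Defs.
From mathcomp Require Import all_boot.
From mathcomp Require Import classical_sets.

(** A cutting length [k] witnesses that [d] is an [a]-floor quotient of [n]
exactly when the remainder [n - k * d] is nonnegative and smaller than [k / a]
([floor_quotientP]). As [k <= n %/ d], a scaling parameter [a >= n %/ d] forces
this remainder to vanish, so [d] divides [n] ([floor_quotient_dvdn]). Divisors
are always [a]-floor quotients, so for such [a] the two relations agree on the
pair [(d, n)].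

Inside an interval between [d] and [n], every pair [x], [y] to be compared has
[y %/ x <= n %/ d], which gives the first half of the theorem. When [d %| n],
the weaker bound [a >= n %/ d.+1] still settles all pairs with [d < x]. The
pairs [(d, e)] remain: once [e] is known to be a divisor of [n], either [e = n],
and divisibility is the hypothesis, or [2 * e <= n], so that
[e %/ d <= n %/ (2 * d) <= n %/ d.+1]. *)

(** The lower bound [a * d <= a * n / k] loses its factor [a]; the upper bound
[a * n < k * (a * d + 1)] rearranges into a bound on the remainder. *)
Lemma floor_quotientP (a d n : nat) : 0 < a ->
  floor_quotient a d n <->
  exists k, [/\ 0 < k, k * d <= n & a * (n - k * d) < k].
Proof.
move=> a_gt0.
have floorE k : 0 < k ->
    (a * d == a * n %/ k) = (k * d <= n) && (a * (n - k * d) < k).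
  move=> k_gt0.
  rewrite eqn_leq andbC -[_ %/ _ <= _]ltnS ltn_divLR // leq_divRL //.
  rewrite -mulnA leq_pmul2l // [d * k]mulnC andbC.
  case: (leqP (k * d) n) => //= kd_le_n.
  rewrite mulnBr ltn_subLR ?leq_pmul2l //.
  by rewrite mulSn addnC -mulnA [d * k]mulnC.
split=> [[k [k_gt0 /eqP]]|[k [k_gt0 kd_le_n rem_lt]]].
  by rewrite floorE // => /andP[]; exists k.
by exists k; split=> //; apply/eqP; rewrite floorE // kd_le_n.
Qed.

Lemma floor_quotient_leq (a d n : nat) :
  0 < a -> floor_quotient a d n -> d <= n.
Proof.
move=> a_gt0 /(floor_quotientP _ _ _ a_gt0)[k [k_gt0 kd_le_n _]].
exact: leq_trans (leq_pmull d k_gt0) kd_le_n.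
Qed.

Lemma dvdn_floor_quotient (a d n : nat) :
  0 < n -> d %| n -> floor_quotient a d n.
Proof.
move=> n_gt0 /dvdnP[k n_eq]; move: n_gt0; rewrite n_eq muln_gt0.
by case/andP=> k_gt0 _; exists k; rewrite mulnCA mulKn.
Qed.

(** The cutting length is at most [n %/ d <= a], while [a] times the remainder
is smaller than it; hence the remainder is zero. *)
Lemma floor_quotient_dvdn (a d n : nat) :
  0 < a -> 0 < d -> n %/ d <= a -> floor_quotient a d n -> d %| n.
Proof.
move=> a_gt0 d_gt0 quo_le_a.
case/(floor_quotientP _ _ _ a_gt0)=> k [_ kd_le_n rem_lt].
have k_le_a : k <= a by apply: leq_trans quo_le_a; rewrite leq_divRL.
have : a * (n - k * d) < a * 1 by rewrite muln1 (leq_trans rem_lt).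
rewrite ltn_pmul2l // ltnS leqn0 subn_eq0 => n_le_kd.
by apply/dvdnP; exists k; apply/eqP; rewrite eqn_leq n_le_kd.
Qed.

(** Since divisors are floor quotients, only implications from floor quotients
to divisibility are left. Once the two sets agree, comparing their elements may
use that these are multiples of [d] and divisors of [n]; this is what decides
the comparisons with smaller element [d] when [a < n %/ d]. *)
Lemma same_poset_intervals (a d n : nat) : 0 < n ->
  (forall e, 0 < e -> floor_quotient a d e -> floor_quotient a e n ->
     d %| e /\ e %| n) ->
  (forall x y, divisor_interval d n x -> divisor_interval d n y ->
     floor_quotient a x y -> x %| y) ->
  same_poset (floor_quotient_interval a d n) (floor_quotient a)
             (divisor_interval d n) divides.
Proof.
move=> n_gt0 fq_dvd fq_dvd_in.
have intervalE : floor_quotient_interval a d n = divisor_interval d n.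
  apply/seteqP; split=> e [e_gt0 de en].
    by have [] := fq_dvd e e_gt0 de en.
  by split; [| exact: dvdn_floor_quotient | exact: dvdn_floor_quotient].
split=> // x y; rewrite intervalE => Dx Dy; split; first exact: fq_dvd_in.
by case: Dy => y_gt0 _ _; exact: dvdn_floor_quotient.
Qed.

Lemma leq_divn2 (d x y n : nat) : 0 < d -> d <= x -> y <= n ->
  y %/ x <= n %/ d.
Proof.
by move=> d_gt0 dx yn; apply: leq_trans (leq_div2r x yn) (leq_div2l n d_gt0 dx).
Qed.

(** A proper divisor [e] of [n] is at most [n / 2], and [d.+1 <= 2 * d]. *)
Lemma proper_divisor_quotient_leq (d e n : nat) :
  0 < d -> e %| n -> e < n -> e %/ d <= n %/ d.+1.
Proof.
move=> d_gt0 /dvdnP[k n_eq] e_lt_n.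
have k_gt1 : 1 < k by move: e_lt_n; rewrite n_eq; case: k {n_eq} => [|[]] //;
  rewrite mul1n ltnn.
rewrite leq_divRL // n_eq.
apply: leq_trans (leq_mul k_gt1 (leqnn e)).
apply: (@leq_trans (e %/ d * (2 * d))).
  by rewrite leq_mul2l mul2n -addnn -addn1 leq_add2l d_gt0 orbT.
by rewrite mulnCA leq_mul2l leq_divM orbT.
Qed.

Theorem theorem1p6 (d n : nat) (d_gt0 : 0 < d) (n_gt0 : 0 < n) :
  (forall a : nat, 0 < a -> n %/ d <= a ->
     same_poset (floor_quotient_interval a d n) (floor_quotient a)
                (divisor_interval d n) divides)
  /\
  (d %| n ->
   forall a : nat, 0 < a -> n %/ d.+1 <= a ->
     same_poset (floor_quotient_interval a d n) (floor_quotient a)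
                (divisor_interval d n) divides).
Proof.
have dvd_of_fq b a x y : 0 < b -> 0 < a -> n %/ b <= a -> b <= x -> y <= n ->
    floor_quotient a x y -> x %| y.
  move=> b_gt0 a_gt0 a_ge b_le_x y_le_n.
  apply: floor_quotient_dvdn => //; first exact: leq_trans b_le_x.
  exact: leq_trans (leq_divn2 _ _ _ _ b_gt0 b_le_x y_le_n) a_ge.
split=> [a a_gt0 a_ge | d_dvd_n a a_gt0 a_ge]; apply: same_poset_intervals => //.
- move=> e _ de en.
  have d_le_e := floor_quotient_leq _ _ _ a_gt0 de.
  have e_le_n := floor_quotient_leq _ _ _ a_gt0 en.
  by split; apply: (dvd_of_fq d a).
- move=> x y [x_gt0 dx _] [_ _ yn].
  by apply: (dvd_of_fq d a) => //; apply: dvdn_leq.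
- move=> e e_gt0 de en.
  have := floor_quotient_leq _ _ _ a_gt0 de.
  rewrite leq_eqVlt => /predU1P[<- // | d_lt_e].
  have e_le_n := floor_quotient_leq _ _ _ a_gt0 en.
  have e_dvd_n : e %| n by apply: (dvd_of_fq d.+1 a).
  split=> //; move: e_le_n; rewrite leq_eqVlt => /predU1P[-> // | e_lt_n].
  apply: floor_quotient_dvdn de => //.
  exact: leq_trans (proper_divisor_quotient_leq _ _ _ d_gt0 e_dvd_n e_lt_n) a_ge.
- move=> x y [x_gt0 dx _] [_ dy yn].
  have := dvdn_leq x_gt0 dx; rewrite leq_eqVlt => /predU1P[<- // | d_lt_x].
  by apply: (dvd_of_fq d.+1 a) => //; apply: dvdn_leq.
Qed.
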